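(* Let $\mathcal{P}$ be any finite set of primes. Then $$\gamma(\mathcal{P})=\prod_{p\in\mathcal{P}}\Big(1-\frac1p\Big)\Big\{\gamma+\sum_{p\in\mathcal{P}}\frac{\log p}{p-1}\Big\}.$$
   Context: $\gamma$ is Euler's constant. For a finite set $\mathcal{P}$ of primes (possibly empty), let $1_{\mathcal{P}}(n)=1$ if $\gcd\big(n,\prod_{p\in\mathcal{P}}p\big)=1$ and $1_{\mathcal{P}}(n)=0$ otherwise, and let $\delta_{\mathcal{P}}=\lim_{x\to\infty}\frac1x\sum_{n\le x}1_{\mathcal{P}}(n)=\prod_{p\in\mathcal{P}}(1-1/p)$. The generalized Euler constant of $\mathcal{P}$ is $$\gamma(\mathcal{P})=\lim_{x\to\infty}\Big\{\sum_{n\le x}\frac{1_{\mathcal{P}}(n)}{n}-\delta_{\mathcal{P}}\log x\Big\}$$ (the limit exists). *)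

(* Defs.v *)
From mathcomp Require Import all_boot all_order all_algebra finmap.
From mathcomp Require Import all_classical all_reals all_analysis.
Set Implicit Arguments.
Unset Strict Implicit.
Unset Printing Implicit Defensive.
Import Order.TTheory GRing.Theory Num.Theory.
Import numFieldNormedType.Exports.
Local Open Scope classical_set_scope.
Local Open Scope ring_scope.

(* Sum over the positive integers n <= x; it is empty when x < 1, in particular
   for negative x, where Num.truncn x = 0. *)
Definition sum_upto (R : realType) (F : nat -> R) (x : R) : R :=
  \sum_(1 <= n < (Num.truncn x).+1) F n.

Definition euler_gamma (R : realType) : R :=
  lim (((\sum_(1 <= k < n.+1) k%:R^-1) - ln n%:R : R) @[n --> \oo]).

Definition ind_coprime (R : realType) (P : {fset nat}) (n : nat) : R :=
  (coprime n (\prod_(p <- P) p)%N)%:R.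

Definition density (R : realType) (P : {fset nat}) : R :=
  lim (x^-1 * sum_upto (ind_coprime R P) x @[x --> +oo]).

Definition gen_euler_fun (R : realType) (P : {fset nat}) (x : R) : R :=
  sum_upto (fun n => ind_coprime R P n / n%:R) x - density R P * ln x.

Definition gen_euler_gamma (R : realType) (P : {fset nat}) : R :=
  lim (gen_euler_fun P x @[x --> +oo]).

(* Main.v *)
Require Import Defs.
From mathcomp Require Import all_boot all_order all_algebra finmap.
From mathcomp Require Import all_classical all_reals all_analysis.
From mathcomp Require Import ring lra.
Import Order.TTheory GRing.Theory Num.Theory.
Import numFieldNormedType.Exports.
Local Open Scope classical_set_scope.
Local Open Scope ring_scope.

(** The set [P] is built up one prime at a time.  If the weights [F] satisfy
    [F (p * m) = F m], then deleting the multiples of [p] changes the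
    summatory functions by rescaled copies of themselves:
      [A x = \sum_(n <= x) F n]      becomes  [A x - A (x / p)],
      [S x = \sum_(n <= x) F n / n]  becomes  [S x - S (x / p) / p].
    Hence [A x ~ d * x] gives the new density [d * (1 - 1/p)]
    ([cvg_mean_sieve]), and since [ln (x / p) = ln x - ln p], the expansion
    [S x = d * ln x + g + o(1)] gives the new constant
    [(1 - 1/p) * g + d * ln p / p] ([cvg_log_mean_sieve]).  With
    [g = d * (c + t)] this equals
    [d * (1 - 1/p) * (c + t + ln p / (p - 1))], so each prime adds one term
    to the sum in the formula.  The indicator of the integers coprime to the
    primes already treated has the required invariance under multiplication by
    a new prime.

    The induction starts from the empty set, with density [1] and constant
    [euler_gamma R]: the numbers [\sum_(k <= n) 1/k - ln n] decrease and are
    nonnegative, hence converge ([cvg_euler_gamma]), and replacing [n] by the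
    integer part of a real [x] costs only [ln (truncn x / x)], which tends to
    [0]. *)

(** * Summation over multiples *)

Lemma sum_nat_multiples (V : nmodType) (p N : nat) (F : nat -> V) :
  (0 < p)%N ->
  \sum_(1 <= n < N.+1 | (p %| n)%N) F n =
  \sum_(1 <= m < (N %/ p).+1) F (p * m)%N.
Proof.
move=> p0; elim: N => [|N IH]; first by rewrite div0n !big_geq.
rewrite big_mkcond big_nat_recr //= -big_mkcond IH divnS //.
have [pN|_] := boolP (p %| N.+1)%N; last by rewrite addr0.
rewrite add1n [RHS]big_nat_recr //=; congr (_ + F _).
have -> : (N %/ p).+1 = (N.+1 %/ p)%N by rewrite divnS // pN.
by rewrite mulnC divnK.
Qed.

Lemma truncn_div_nat (R : realType) (x : R) (p : nat) :
  (0 < p)%N -> 0 <= x -> Num.truncn (x / p%:R) = (Num.truncn x %/ p)%N.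
Proof.
move=> p0 x0; have p0R : 0 < p%:R :> R by rewrite ltr0n.
apply: truncn_def; rewrite ler_pdivlMr // ltr_pdivrMr // -!natrM.
by rewrite -truncn_ge_nat // -truncn_lt_nat // leq_divM ltn_ceil.
Qed.

(** The multiples of [p] up to [x] are the [p * m] with [m <= x / p]; no
    rounding is lost, as [truncn (x / p)] is the integer quotient
    [truncn x %/ p]. *)
Lemma sum_upto_sieve (R : realType) (p : nat) (F : nat -> R) (x : R) :
  (0 < p)%N -> 0 <= x ->
  sum_upto (fun n => (~~ (p %| n)%N)%:R * F n) x =
  sum_upto F x - sum_upto (fun m => F (p * m)%N) (x / p%:R).
Proof.
move=> p0 x0; rewrite /sum_upto truncn_div_nat // -sum_nat_multiples //.
rewrite [X in X - _](bigID (fun n => p %| n)%N) /= addrC addrK.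
rewrite [RHS]big_mkcond /=; apply: eq_bigr => n _.
by case: (p %| n)%N; rewrite ?mul0r ?mul1r.
Qed.

(** * Sieving by one prime *)

Section SieveByOnePrime.
Context {R : realType} (p : nat) (F : nat -> R).
Hypotheses (p0 : (0 < p)%N) (Fp : forall m, F (p * m)%N = F m).

Lemma cvg_comp_div_nat (f : R -> R) (l : R) :
  f x @[x --> +oo] --> l -> f (x / p%:R) @[x --> +oo] --> l.
Proof.
move=> fl; apply: (@cvg_comp _ _ _ (fun x : R => x / p%:R) f _ _ _ _ fl).
by apply: gt0_cvgMly; [rewrite invr_gt0 ltr0n | exact: cvg_id].
Qed.

Lemma cvg_mean_sieve (d : R) :
  x^-1 * sum_upto F x @[x --> +oo] --> d ->
  x^-1 * sum_upto (fun n => (~~ (p %| n)%N)%:R * F n) x @[x --> +oo]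
    --> d * (1 - p%:R^-1).
Proof.
move=> Fd.
have -> : d * (1 - p%:R^-1) = d - p%:R^-1 * d by ring.
apply: cvg_trans; last first.
  exact: cvgB Fd (cvgMl_tmp (a := p%:R^-1) (cvg_comp_div_nat _ _ Fd)).
apply: near_eq_cvg; near=> x; rewrite !fctE.
have x0 : 0 < x by near: x; exact: nbhs_pinfty_gt.
rewrite sum_upto_sieve ?ltW // mulrBr (_ : (fun m => F (p * m)%N) = F).
  by rewrite invfM invrK mulrA [p%:R^-1 * _]mulrCA mulVf ?mulr1 ?pnatr_eq0
             ?lt0n_neq0.
by apply/funext => m.
Unshelve. all: by end_near. Qed.

(** The three terms of the limit come from [S x], from [S (x / p) / p], and
    from [d / p * ln x = d / p * ln (x / p) + d * ln p / p]. *)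
Lemma cvg_log_mean_sieve (d g : R) :
  sum_upto (fun n => F n / n%:R) x - d * ln x @[x --> +oo] --> g ->
  sum_upto (fun n => (~~ (p %| n)%N)%:R * F n / n%:R) x
    - d * (1 - p%:R^-1) * ln x @[x --> +oo]
    --> (1 - p%:R^-1) * g + d * (ln p%:R / p%:R).
Proof.
move=> Fg.
have -> : (1 - p%:R^-1) * g + d * (ln p%:R / p%:R)
    = g - p%:R^-1 * g + d * (ln p%:R / p%:R) by ring.
apply: cvg_trans; last first.
  exact: cvgD (cvgB Fg (cvgMl_tmp (a := p%:R^-1) (cvg_comp_div_nat _ _ Fg)))
              (cvg_cst (d * (ln p%:R / p%:R))).
apply: near_eq_cvg; near=> x; rewrite !fctE.
have x0 : 0 < x by near: x; exact: nbhs_pinfty_gt.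
have -> : sum_upto (fun n => (~~ (p %| n)%N)%:R * F n / n%:R) x
    = sum_upto (fun n => (~~ (p %| n)%N)%:R * (F n / n%:R)) x.
  by apply: eq_bigr => n _; rewrite mulrA.
rewrite sum_upto_sieve ?ltW //.
have -> : sum_upto (fun m => F (p * m)%N / (p * m)%:R) (x / p%:R)
    = p%:R^-1 * sum_upto (fun m => F m / m%:R) (x / p%:R).
  rewrite /sum_upto mulr_sumr; apply: eq_bigr => m _.
  by rewrite Fp natrM invfM mulrCA.
by rewrite ln_div ?posrE ?ltr0n //; ring.
Unshelve. all: by end_near. Qed.

End SieveByOnePrime.

(** * The empty set of primes *)

Lemma cvg_truncn_ratio (R : realType) :
  x^-1 * (Num.truncn x)%:R @[x --> (+oo : set_system R)] --> (1 : R).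
Proof.
have inv0 : x^-1 @[x --> (+oo : set_system R)] --> (0 : R).
  apply: (gtr0_cvgV0 (f := fun x : R => x) _).2; last exact: cvg_id.
  exact: nbhs_pinfty_gt.
have lo : 1 - x^-1 @[x --> (+oo : set_system R)] --> (1 : R).
  rewrite -[X in _ --> X]subr0; apply: cvgB inv0; exact: cvg_cst.
apply: (squeeze_cvgr _ lo (cvg_cst (1 : R))); near=> x.
have x0 : 0 < x by near: x; exact: nbhs_pinfty_gt.
rewrite ![x^-1 * _]mulrC ler_pdivlMr // ler_pdivrMr // mul1r truncn_le.
rewrite [0 <= x]ltW // andbT mulrBl mul1r mulVf ?gt_eqF //.
by rewrite lerBlDr natr1 ltW // truncnS_gt.
Unshelve. all: by end_near. Qed.

(** The two estimates on the logarithm are both [ln (1 + t) <= t]: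
    at [t = -1/(n+2)] it makes the sequence decrease, and at [t = 1/(n+1)]
    it keeps the harmonic sums above the logarithm. *)
Lemma cvg_euler_gamma (R : realType) :
  (\sum_(1 <= k < n.+1) k%:R^-1 - ln n%:R : R) @[n --> \oo] --> euler_gamma R.
Proof.
pose u n : R := \sum_(1 <= k < n.+1) k%:R^-1 - ln n%:R.
(* [u 0 = 0 < u 1] because [ln 0] is [0] by convention; the sequence decreases
   from the index 1 on. *)
suff : cvgn [sequence u n.+1]_n.
  by move=> cu; apply: cvgP; move: cu; rewrite cvg_shiftS; exact.
have lnS n : n.+2%:R^-1 <= ln (n.+2%:R : R) - ln n.+1%:R <= n.+1%:R^-1.
  have n1 : 0 < n.+1%:R :> R by [].
  have n2 : 0 < n.+2%:R :> R by [].
  have nE : n.+2%:R = n.+1%:R + 1 :> R by rewrite natr1.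
  apply/andP; split.
    rewrite -lerN2 opprB -ln_div ?posrE //.
    have -> : n.+1%:R / n.+2%:R = 1 + - n.+2%:R^-1 :> R.
      by rewrite -[n.+1%:R](addrK 1) -nE mulrBl divff ?gt_eqF // mul1r.
    by apply: le_ln1Dx; rewrite ltrN2 invf_lt1 // ltr1n.
  rewrite -ln_div ?posrE //.
  have -> : n.+2%:R / n.+1%:R = 1 + n.+1%:R^-1 :> R.
    by rewrite nE mulrDl divff ?gt_eqF // mul1r.
  apply: le_ln1Dx; apply: (@lt_trans _ _ 0); by rewrite ?invr_gt0 // ltrN10.
apply: nonincreasing_is_cvgn.
  apply/nonincreasing_seqP => n /=; rewrite /u [in X in X <= _]big_nat_recr //=.
  have /andP[dec _] := lnS n.
  by rewrite -addrA lerD2l lerBlDr addrC.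
exists 0 => _ [n _ <-] /=; rewrite /u.
have H m : ln m.+1%:R <= \sum_(1 <= k < m.+1) k%:R^-1 :> R.
  elim: m => [|m IH]; first by rewrite big_geq // ln1.
  rewrite big_nat_recr //=; have /andP[_ inc] := lnS m.
  by rewrite (le_trans (y := ln m.+1%:R + m.+1%:R^-1)) ?lerD2r // -lerBlDl.
rewrite subr_ge0; apply: le_trans (H n.+1).
by rewrite ler_ln ?posrE // ler_nat.
Qed.

(** With [N = truncn x], one has [ln x = ln N - ln (N / x)], so the real
    variable reduces to the integer one up to a vanishing term. *)
Lemma cvg_log_mean_one (R : realType) :
  sum_upto (fun n => n%:R^-1) x - ln x @[x --> (+oo : set_system R)]
    --> euler_gamma R.
Proof.
have trunc_oo : Num.truncn x @[x --> (+oo : set_system R)] --> \oo.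
  apply/cvgnyPge => N; near=> x.
  rewrite truncn_ge_nat; last by near: x; exact: nbhs_pinfty_ge.
  by near: x; exact: nbhs_pinfty_ge.
have ln0 : ln (x^-1 * (Num.truncn x)%:R) @[x --> (+oo : set_system R)]
    --> (0 : R).
  rewrite -ln1; apply: continuous_cvg (cvg_truncn_ratio R).
  exact: continuous_ln.
rewrite -[X in _ --> X]addr0.
apply: cvg_trans; last first.
  exact: cvgD (cvg_comp _ _ trunc_oo (cvg_euler_gamma R)) ln0.
apply: near_eq_cvg; near=> x; rewrite fctE /=.
have x1 : 1 <= x by near: x; exact: nbhs_pinfty_ge.
have x0 : 0 < x by apply: lt_le_trans x1.
rewrite lnM ?posrE ?invr_gt0 ?ltr0n ?truncn_gt0 // lnV ?posrE // /sum_upto.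
ring.
Unshelve. all: by end_near. Qed.

(** * All the primes *)

(** For [s] the list of elements of [P] this is convertible to
    [ind_coprime R P]; a list lets the primes be added one by one. *)
Definition coprime_to (R : realType) (s : seq nat) (n : nat) : R :=
  (coprime n (\prod_(p <- s) p)%N)%:R.

Lemma coprime_to_cons (R : realType) (p : nat) (s : seq nat) (n : nat) :
  prime p ->
  coprime_to R (p :: s) n = (~~ (p %| n)%N)%:R * coprime_to R s n.
Proof.
move=> pp; rewrite /coprime_to big_cons coprimeMr coprime_sym prime_coprime //.
by rewrite -natrM mulnb.
Qed.

Lemma coprime_toM (R : realType) (p : nat) (s : seq nat) (m : nat) :
  prime p -> {in s, forall q, prime q} -> p \notin s ->
  coprime_to R s (p * m) = coprime_to R s m.
Proof.
move=> pp sP ps; rewrite /coprime_to coprimeMl.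
suff -> : coprime p (\prod_(q <- s) q)%N by [].
elim: s sP ps => [|q s IH] sP; first by rewrite big_nil coprimen1.
rewrite inE negb_or big_cons coprimeMr => /andP[pq ps].
rewrite prime_coprime // dvdn_prime2 ?(sP q) ?mem_head // pq /=.
by apply: IH => // r rs; apply: sP; rewrite inE rs orbT.
Qed.

(** The density and the logarithmic expansion go through the induction
    together: the theorem defines the coefficient of [ln x] as a limit, and
    the first part evaluates it. *)
Lemma cvg_coprime_to (R : realType) (s : seq nat) :
  uniq s -> {in s, forall p, prime p} ->
  let d := \prod_(p <- s) (1 - p%:R^-1) : R in
  x^-1 * sum_upto (coprime_to R s) x @[x --> +oo] --> d /\
  sum_upto (fun n => coprime_to R s n / n%:R) x - d * ln x @[x --> +oo]
    --> d * (euler_gamma R + \sum_(p <- s) (ln p%:R / (p%:R - 1))).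
Proof.
elim: s => [_ _ d|p s IH /= /andP[ps us] sP].
  have one n : coprime_to R [::] n = 1 by rewrite /coprime_to big_nil coprimen1.
  have -> : coprime_to R [::] = fun=> 1 by apply/funext.
  rewrite /d !big_nil mul1r addr0; split.
    under eq_fun do rewrite /sum_upto sumr_const_nat subn1.
    exact: cvg_truncn_ratio.
  under eq_fun do rewrite mul1r.
  have -> : (fun n : nat => 1 / n%:R) = (fun n => n%:R^-1 : R).
    by apply/funext => n; rewrite mul1r.
  exact: cvg_log_mean_one.
have pp : prime p by apply: sP; rewrite mem_head.
have {}sP : {in s, forall q, prime q}.
  by move=> q qs; apply: sP; rewrite inE qs orbT.
have [IHd IHg] := IH us sP.
have Fp m : coprime_to R s (p * m) = coprime_to R s m by exact: coprime_toM.
have -> : coprime_to R (p :: s)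
    = fun n => (~~ (p %| n)%N)%:R * coprime_to R s n.
  by apply/funext => n; exact: coprime_to_cons.
rewrite !big_cons [(1 - _) * _]mulrC; split.
  exact: cvg_mean_sieve (prime_gt0 pp) Fp _ IHd.
have -> : \prod_(q <- s) (1 - q%:R^-1) * (1 - p%:R^-1)
      * (euler_gamma R + (ln p%:R / (p%:R - 1)
         + \sum_(q <- s) (ln q%:R / (q%:R - 1))))
    = (1 - p%:R^-1) * (\prod_(q <- s) (1 - q%:R^-1)
      * (euler_gamma R + \sum_(q <- s) (ln q%:R / (q%:R - 1))))
      + \prod_(q <- s) (1 - q%:R^-1) * (ln p%:R / p%:R) :> R.
  field; rewrite subr_eq0 !pnatr_eq0 pnatr_eq1.
  by rewrite -lt0n prime_gt0 // gtn_eqF // prime_gt1.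
exact: cvg_log_mean_sieve (prime_gt0 pp) Fp _ _ IHg.
Qed.

Theorem proposition1 (R : realType) (P : {fset nat})
    (hP : forall p : nat, p \in P -> prime p) :
  cvg (gen_euler_fun P x @[x --> (+oo : set_system R)]) /\
  gen_euler_gamma R P =
    \prod_(p <- P) (1 - p%:R^-1) *
    (euler_gamma R + \sum_(p <- P) (ln p%:R / (p%:R - 1))).
Proof.
have [cd cg] := cvg_coprime_to R _ (fset_uniq P) hP.
have dE : density R P = \prod_(p <- P) (1 - p%:R^-1).
  by apply: cvg_lim cd; exact: norm_hausdorff.
have {}cg : gen_euler_fun P x @[x --> (+oo : set_system R)] -->
    \prod_(p <- P) (1 - p%:R^-1) *
    (euler_gamma R + \sum_(p <- P) (ln p%:R / (p%:R - 1))).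
  by rewrite /gen_euler_fun dE; exact: cg.
split; first by apply/cvg_ex; eexists; exact: cg.
by apply: cvg_lim cg; exact: norm_hausdorff.
Qed.
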